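(* Let $T=(V,E)$ be a combinatorial tree, let $i,j\in V$ be fixed with $i\neq j$, and let $\alpha\in[0,1)$. Then the Ollivier-Ricci curvature is given as follows. If $\{i,j\}\in E$, then $$\kappa^{\mathsf{or},\alpha}_{ij}=\begin{cases}2\alpha & \text{if } \frac{1}{\mathrm{d}(i)}+\frac{1}{\mathrm{d}(j)}>\frac{1}{1-\alpha},\\[4pt] 2(1-\alpha)\left(\frac{1}{\mathrm{d}(i)}+\frac{1}{\mathrm{d}(j)}-1\right) & \text{if } \frac{1}{\mathrm{d}(i)}+\frac{1}{\mathrm{d}(j)}\le\frac{1}{1-\alpha}.\end{cases}$$ In particular, if $\alpha\ge 1/2$, the latter case applies. If $i\nsim j$, then $$\kappa^{\mathsf{or},\alpha}_{ij}=\frac{2(1-\alpha)}{\Delta(i,j)}\left(\frac{1}{\mathrm{d}(i)}+\frac{1}{\mathrm{d}(j)}-1\right).$$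
   Context: A tree is a finite, simple, connected, acyclic graph; a combinatorial tree is a tree with all edge weights equal to one. Write $V=\{1,\dots,n\}$, $i\sim j$ if $\{i,j\}\in E$, and $\mathrm{d}(i)$ for the degree of $i$ (number of incident edges). $\Delta(i,j)$ is the shortest path distance (number of edges in a shortest path). For $\alpha\in[0,1)$ and $i\in V$, the $\alpha$-lazy random walk measure $m_i^{(\alpha)}$ is the probability measure on $V$ with $m_i^{(\alpha)}(i)=\alpha$, $m_i^{(\alpha)}(x)=(1-\alpha)/\mathrm{d}(i)$ if $x\sim i$, and $m_i^{(\alpha)}(x)=0$ otherwise. For probability measures $\mu,\nu$ on $V$, $$\mathsf{W}_1(\mu,\nu)=\inf\Big\{\sum_{i,j\in V}\pi_{ij}\Delta(i,j):\ \pi\in\mathbb{R}^{n\times n},\ \pi_{ij}\ge 0,\ \mathbf{1}^T\pi=\mu^T,\ \pi\mathbf{1}=\nu\Big\},$$ where $\mathbf 1$ is the all-ones vector. The Ollivier-Ricci curvature is $\kappa^{\mathsf{or},\alpha}_{ij}=1-\mathsf{W}_1(m_i^{(\alpha)},m_j^{(\alpha)})/\Delta(i,j)$ for $i\neq j$. *)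

(* Defs.v *)
From HB Require Import structures.
From mathcomp Require Import all_boot all_order all_algebra.
From mathcomp Require Import classical_sets reals.

Set Implicit Arguments.
Unset Strict Implicit.
Unset Printing Implicit Defensive.

Import Order.TTheory GRing.Theory Num.Theory.
Local Open Scope ring_scope.
Local Open Scope classical_set_scope.

(* A finite simple graph on the vertex set 'I_n is given by its adjacency
   relation.  In a simple graph a cycle has at least three vertices: the bound
   on the size excludes the back-and-forth closed walk along one edge. *)
Definition is_tree (n : nat) (e : rel 'I_n) : Prop :=
  [/\ symmetric e, irreflexive e,
      forall x y : 'I_n, connect e x y
    & forall c : seq 'I_n, (2 < size c)%N -> ~ ucycle e c].

Definition degree (n : nat) (e : rel 'I_n) (i : 'I_n) : nat :=
  #|[set x : 'I_n | e i x]%SET|.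

Definition has_path_of_length (n : nat) (e : rel 'I_n) (i j : 'I_n) (k : nat)
    : bool :=
  [exists p : k.-tuple 'I_n,
    [&& path e i p, uniq (i :: p) & last i p == j]].

(* A path without repeated vertices has fewer than n edges, so the minimum
   ranges over all path lengths; the default value n is only taken when j is
   not reachable from i. *)
Definition dist (n : nat) (e : rel 'I_n) (i j : 'I_n) : nat :=
  \big[minn/n]_(k < n | has_path_of_length e i j k) k.

Section Transport.
Variables (R : realType) (n : nat) (e : rel 'I_n).

Definition lazy_walk (alpha : R) (i : 'I_n) : 'cV[R]_n :=
  \col_x (if x == i then alpha
          else if e i x then (1 - alpha) / (degree e i)%:R
          else 0).

Definition couplings (mu nu : 'cV[R]_n) : set 'M[R]_n :=
  [set p : 'M[R]_n | [/\ forall x y, 0 <= p x y,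
                        (const_mx 1 : 'cV[R]_n)^T *m p = mu^T
                      & p *m (const_mx 1 : 'cV[R]_n) = nu]].

Definition transport_cost (p : 'M[R]_n) : R :=
  \sum_x \sum_y p x y * (dist e x y)%:R.

Definition W1 (mu nu : 'cV[R]_n) : R :=
  inf [set transport_cost p | p in couplings mu nu].

Definition ollivier_ricci (alpha : R) (i j : 'I_n) : R :=
  1 - W1 (lazy_walk alpha i) (lazy_walk alpha j) / (dist e i j)%:R.

End Transport.

(* Main.v *)
Require Import Defs.
From mathcomp Require Import all_boot all_order all_algebra.
From mathcomp Require Import classical_sets reals.
From mathcomp Require Import zify ring lra.

Set Implicit Arguments.
Unset Strict Implicit.
Unset Printing Implicit Defensive.

Import Order.TTheory GRing.Theory Num.Theory.
Local Open Scope ring_scope.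

(** Write [mu] and [nu] for the walks started at [i] and [j], with masses
    [a = (1 - alpha) / d(i)] and [b = (1 - alpha) / d(j)] on each neighbour of
    their centres.  On a tree, transport is forced edge by edge: each edge
    is crossed by the difference of the masses that [mu] and [nu] put on one of
    its sides.  So the mass of [mu] on the
    neighbours of [i] off the segment from [i] to [j] moves to [i], mass leaves
    [j] for the neighbours of [j] off the segment, and the only question is the
    direction of the flow on the segment.

    If [i] and [j] are not adjacent, or [a + b <= 1], everything flows from [i]
    towards [j].  The certificate is a four-point identity: for [x] in the
    closed neighbourhood of [j] and [y] in that of [i],
      [dist x y = dist x i + dist y j - dist i j],
    except when [x = i], [y = j] and [i], [j] are adjacent, where the left-hand
    side is larger ([tight_near_endpoints]).  The right-hand side splits as a function of [x]
    plus a function of [y], so its integral depends on the marginals alone, and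
    any coupling giving no mass to the exceptional pair is optimal
    ([W1_forward]).

    If [i] and [j] are adjacent and [a + b >= 1], the edge is crossed from [j]
    to [i] instead.  The dual certificate takes the values 0 and -1 only, and
    the optimal coupling moves mass only to [i] or from [j] ([W1_backward]).

    Both couplings belong to one family: with [d_i], [d_j] the Dirac masses,
      [p x y = nu x * mu y - t * (d_i x - nu x) * (d_j y - mu y)]
    has marginals [mu] and [nu] for every [t], because a difference of two
    probability measures has total mass 0.  The first case uses the [t] that
    makes the entry at [(i, j)] vanish, the second uses [t = 1].

    What makes a tree a tree is used through one fact: an edge is a bridge
    ([edge_bridge]).  It follows that moving along an edge changes the distance
    to any vertex by exactly one, and that exactly one neighbour of [i] is
    closer to a given [z != i].  This evaluates the mean distances and yields
    the four-point identity. *)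

(** * Distances in a tree *)

Section TreeDistance.
Variables (n : nat) (e : rel 'I_n).
Hypothesis treeP : is_tree e.
Implicit Types x y z i j : 'I_n.

Let adj_sym : symmetric e. Proof. by case: treeP. Qed.
Let adj_irr : irreflexive e. Proof. by case: treeP. Qed.

Let uniq_size (s : seq 'I_n) : uniq s -> (size s <= n)%N.
Proof. by move=> /card_uniqP <-; rewrite -[leqRHS]card_ord max_card. Qed.

(** Repetitions can be removed from a walk without lengthening it, so [dist] is
    bounded by arbitrary walks; with [geodesic] this allows the metric facts to
    be proved by concatenating and reversing walks without caring about
    repeated vertices. *)
Lemma dist_le_size x p : path e x p -> (dist e x (last x p) <= size p)%N.
Proof.
case/shortenP=> p' ep' up' sub_p'p.
have lt_p'n : (size p' < n)%N := uniq_size up'.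
have le_p'p : (size p' <= size p)%N.
  by apply: uniq_leq_size sub_p'p; case/andP: up'.
apply: leq_trans le_p'p; rewrite /dist -minEnat -leEnat.
apply: (bigmin_inf (Ordinal lt_p'n)) => //=.
by apply/existsP; exists (in_tuple p'); rewrite ep' up' /=.
Qed.

Lemma geodesic x y :
  exists p, [/\ path e x p, last x p = y & size p = dist e x y].
Proof.
have [_ _ /(_ x y)/connectP[q eq ->] _] := treeP.
have : dist e x (last x q) = n \/
    exists p, [/\ path e x p, last x p = last x q
                 & size p = dist e x (last x q)].
  apply: (big_ind (fun m => m = n \/
      exists p, [/\ path e x p, last x p = last x q & size p = m])).
  - by left.
  - by move=> m1 m2; rewrite /minn; case: ifP.
  - move=> k /existsP[p /and3P[ep _ /eqP <-]]; right; exists p.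
    by rewrite size_tuple.
(* The default value [n] of the minimum exceeds the length of a simple path. *)
case=> // dist_n; case/shortenP: eq dist_n => q' eq' uq' _ dist_n.
by have := dist_le_size eq'; have := uniq_size uq'; rewrite dist_n /=; lia.
Qed.

Lemma dist_refl x : dist e x x = 0%N.
Proof. by apply/eqP; rewrite -leqn0; apply: (@dist_le_size x [::]). Qed.

Lemma dist_eq0 x y : (dist e x y == 0%N) = (x == y).
Proof.
apply/eqP/eqP => [d0|->]; last exact: dist_refl.
by have [p [_ + +]] := geodesic x y; rewrite d0; case: p.
Qed.

Lemma dist_triangle y x z : (dist e x z <= dist e x y + dist e y z)%N.
Proof.
have [p [ep ly <-]] := geodesic x y; have [q [eq <- <-]] := geodesic y z.
rewrite -ly -last_cat -size_cat; apply: dist_le_size.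
by rewrite cat_path ep ly.
Qed.

Lemma dist_sym x y : dist e x y = dist e y x.
Proof.
suff le_d u v : (dist e v u <= dist e u v)%N by apply/eqP; rewrite eqn_leq !le_d.
have [p [ep <- <-]] := geodesic u v.
have := @dist_le_size (last u p) (rev (belast u p)).
rewrite rev_path (eq_path (e' := e)) => [|s t]; last by rewrite adj_sym.
rewrite size_rev size_belast => /(_ ep).
by case: p {ep} => [|s p] /=; rewrite ?dist_refl // rev_cons last_rcons.
Qed.

Lemma dist_edge_le x y : e x y -> (dist e x y <= 1)%N.
Proof. by move=> exy; apply: (@dist_le_size x [:: y]); rewrite /= exy. Qed.

Lemma edge_neq x y : e x y -> x != y.
Proof. by apply: contraTneq => ->; rewrite adj_irr. Qed.

Lemma dist_edge x y : e x y -> dist e x y = 1%N.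
Proof.
move=> exy; have := dist_edge_le exy; have := dist_eq0 x y.
by rewrite (negPf (edge_neq exy)); case: (dist e x y) => [|[]].
Qed.

Definition del_edge i y : rel 'I_n :=
  fun u v => e u v && ~~ (((u == i) && (v == y)) || ((u == y) && (v == i))).

Lemma del_edge_connect_sym i y : connect_sym (del_edge i y).
Proof.
apply: sym_connect_sym => u v; rewrite /del_edge adj_sym.
by rewrite orbC (andbC (u == y)) (andbC (u == i)).
Qed.

(** A simple path from [i] to [y] avoiding the edge has at least two steps, and
    the edge would close it into a cycle. *)
Lemma edge_bridge i y : e i y -> ~~ connect (del_edge i y) i y.
Proof.
move=> eiy; apply/negP => /connectP[p ep ly].
case/shortenP: ep ly => p' ep' up' _ ly.
have [_ _ _ /(_ (i :: p'))] := treeP; apply.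
  case: p' ep' ly {up'} => [|s [|t p']] //=.
    by move=> _ yi; rewrite yi adj_irr in eiy.
  by rewrite andbT => + ys; rewrite /del_edge ys !eqxx andbF.
rewrite /ucycle up' andbT /= rcons_path -ly (adj_sym y) eiy andbT.
by apply: sub_path ep' => u v /andP[].
Qed.

(** The geodesic from [u] to [z] cannot visit [i]: its part after [i] would be
    too short. *)
Lemma connect_avoiding i y u z : (dist e u z <= dist e i z)%N -> u != i ->
  connect (del_edge i y) u z.
Proof.
move=> le_uz ui; have [p [ep lz sz_p]] := geodesic u z.
have ip : i \notin p.
  apply/negP => ip; case/splitPr: ip ep lz sz_p => p1 p2.
  rewrite cat_path last_cat size_cat /= => /and3P[_ _ ep2] lz sz_p.
  by have := dist_le_size ep2; rewrite lz; lia.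
apply/connectP; exists p => //.
apply: (sub_in_path (P := predC1 i)) ep.
  by move=> s t /negPf si /negPf ti est; rewrite /del_edge est si ti andbF.
by rewrite /= ui; apply/allP => t tp /=; apply: contraNneq ip => <-.
Qed.

(** If [i] and [y] were equidistant from [z], the geodesics to [z] would connect
    them without using the edge between them, which is a bridge. *)
Lemma dist_neighbor i y z : e i y ->
  dist e i z = (dist e y z).+1 \/ dist e y z = (dist e i z).+1.
Proof.
move=> eiy; have yi := edge_neq eiy.
have d_yi : dist e y i = 1%N by rewrite dist_sym dist_edge.
have := dist_triangle y i z; have := dist_triangle i y z.
rewrite d_yi (dist_edge eiy).
suff: dist e i z <> dist e y z by lia.
move=> d_eq; have := edge_bridge eiy; rewrite (connect_trans (y := z)) //.
  have e_swap : del_edge i y =2 del_edge y i.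
    by move=> u v; rewrite /del_edge orbC.
  by rewrite (eq_connect e_swap) connect_avoiding ?d_eq.
by rewrite del_edge_connect_sym connect_avoiding ?d_eq // eq_sym.
Qed.

Lemma closer_neighbor i z : i != z ->
  exists2 y, e i y & dist e i z = (dist e y z).+1.
Proof.
have [[|y p] [/= ep lz sz_p]] := geodesic i z; first by rewrite lz eqxx.
case/andP: ep => eiy ep _; exists y => //.
have := dist_le_size ep; rewrite lz.
by case: (dist_neighbor z eiy) => //; lia.
Qed.

(** Otherwise [i], [y'], [z], [y] would be joined by a walk avoiding the bridge
    between [i] and [y], since the geodesics from [y'] and [y] avoid [i]. *)
Lemma closer_neighbor_uniq i z y y' : e i y -> e i y' ->
  dist e i z = (dist e y z).+1 -> dist e i z = (dist e y' z).+1 -> y = y'.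
Proof.
move=> eiy eiy' dy dy'; apply/eqP; apply: contraTT isT => neq_yy'.
have := edge_bridge eiy; rewrite (connect_trans (y := z)) //.
  apply: (@connect_trans _ _ y').
    apply: connect1; rewrite /del_edge eiy' eqxx /=.
    by rewrite (negPf (edge_neq eiy)) orbF eq_sym.
  by apply: connect_avoiding; [lia | rewrite eq_sym edge_neq].
rewrite del_edge_connect_sym.
by apply: connect_avoiding; [lia | rewrite eq_sym edge_neq].
Qed.

(** The first step of the geodesic from [i] does not change when the target moves
    along an edge without reaching [i].  If [y] were not the first step towards
    [z'], that first step [y'] would lead to [z] as well, as [z] would have to be
    farther than [z']; this contradicts uniqueness. *)
Lemma closer_transfer i y z z' : e i y -> e z z' -> z' != i ->
  dist e i z = (dist e y z).+1 -> dist e i z' = (dist e y z').+1.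
Proof.
move=> eiy ezz' z'i dz.
case: (dist_neighbor z' eiy) => // far.
have d_z'z : dist e z' z = 1%N by rewrite dist_sym dist_edge.
have iz' : i != z' by rewrite eq_sym.
have [y' eiy' dy'] := closer_neighbor iz'.
have t1 := dist_triangle z y z'; have t2 := dist_triangle z' y' z.
rewrite (dist_edge ezz') in t1; rewrite d_z'z in t2.
have eyy' : y = y'.
  apply: (closer_neighbor_uniq eiy eiy' dz).
  by case: (dist_neighbor z eiy'); lia.
by rewrite -eyy' in dy'; lia.
Qed.

(** Apart from degenerate positions, the identity says that [y] is closer than
    [i] to [x] exactly when it is closer than [i] to [j]; this is
    [closer_transfer] applied along the edge between [j] and [x], both ways. *)
Lemma tight_near_endpoints i j x y : i != j ->
  (x == j) || e j x -> (y == i) || e i y -> ~~ ((x == i) && (y == j)) ->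
  (dist e x y + dist e i j = dist e i x + dist e y j)%N.
Proof.
move=> ij /orP[/eqP-> _ _|ejx]; first by rewrite addnC (dist_sym j).
case/orP=> [/eqP-> _|eiy]; first by rewrite (dist_sym x).
have [xi|xi] /= := eqVneq x i => [yj|_].
  rewrite xi in ejx *; have eij : e i j by rewrite adj_sym.
  rewrite dist_refl (dist_edge eij) (dist_edge eiy).
  case: (dist_neighbor j eiy); last first.
    by rewrite (dist_edge eij) => ->.
  by rewrite (dist_edge eij) => -[/esym/eqP]; rewrite dist_eq0 (negPf yj).
have [yj|yj] := eqVneq y j.
  rewrite yj in eiy *.
  rewrite dist_refl (dist_sym x) (dist_edge ejx) (dist_edge eiy).
  case: (dist_neighbor x eiy); rewrite (dist_edge ejx); first by move=> ->.
  by case=> /esym/eqP; rewrite dist_eq0 eq_sym (negPf xi).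
rewrite (dist_sym x y).
have := @closer_transfer i y j x eiy ejx xi.
have := @closer_transfer i y x j eiy.
rewrite adj_sym ejx eq_sym ij => /(_ isT isT).
have := dist_neighbor x eiy; have := dist_neighbor j eiy; lia.
Qed.

End TreeDistance.

(** * Optimal transport between two finitely supported measures *)

Section Transport.
Variables (R : realType) (n : nat) (e : rel 'I_n).
Implicit Types (mu nu : 'cV[R]_n) (p : 'M[R]_n) (phi psi : 'I_n -> R).

Lemma couplingsP mu nu p : couplings mu nu p <->
  [/\ forall x y, 0 <= p x y, forall y, \sum_x p x y = mu y 0
    & forall x, \sum_y p x y = nu x 0].
Proof.
have colE y : ((const_mx 1 : 'cV[R]_n)^T *m p) 0 y = \sum_x p x y.
  by rewrite mxE; apply: eq_bigr => x _; rewrite !mxE mul1r.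
have rowE x : (p *m (const_mx 1 : 'cV[R]_n)) x 0 = \sum_y p x y.
  by rewrite mxE; apply: eq_bigr => y _; rewrite !mxE mulr1.
split=> [[p_ge0 colp rowp]|[p_ge0 colp rowp]]; split=> //.
- by move=> y; rewrite -colE colp mxE.
- by move=> x; rewrite -rowE rowp.
- by apply/rowP => y; rewrite colE colp mxE.
- by apply/colP => x; rewrite rowE rowp.
Qed.

Lemma coupling_supp mu nu p x y : couplings mu nu p ->
  p x y != 0 -> (nu x 0 != 0) && (mu y 0 != 0).
Proof.
case/couplingsP=> p_ge0 colp rowp pxy.
have pxy_gt0 : 0 < p x y by rewrite lt_def pxy p_ge0.
apply/andP; split; rewrite gt_eqF //.
  rewrite -rowp (bigD1 y) //=.
  by apply: ltr_wpDr => //; apply: sumr_ge0.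
rewrite -colp (bigD1 x) //=.
by apply: ltr_wpDr => //; apply: sumr_ge0.
Qed.

Lemma coupling_potential mu nu p phi psi : couplings mu nu p ->
  \sum_x \sum_y p x y * (phi x - psi y) =
  \sum_x nu x 0 * phi x - \sum_y mu y 0 * psi y.
Proof.
case/couplingsP=> _ colp rowp.
transitivity (\sum_x (\sum_y p x y * phi x - \sum_y p x y * psi y)).
  apply: eq_bigr => x _; rewrite -sumrB.
  by apply: eq_bigr => y _; rewrite mulrBr.
rewrite sumrB; congr (_ - _).
  by apply: eq_bigr => x _; rewrite -mulr_suml rowp.
by rewrite exchange_big; apply: eq_bigr => y _; rewrite -mulr_suml colp.
Qed.

(** Complementary slackness in the Kantorovich duality: potentials below the
    distance on the product of the supports and equal to it on the support of
    [p] certify that [p] is optimal.  Two unrelated potentials, each relevant on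
    one support only, spare the construction of a single Lipschitz function on
    the whole graph. *)
Lemma W1_duality mu nu p phi psi : couplings mu nu p ->
  (forall x y, nu x 0 != 0 -> mu y 0 != 0 ->
     phi x - psi y <= (dist e x y)%:R) ->
  (forall x y, p x y != 0 -> (dist e x y)%:R = phi x - psi y) ->
  W1 e mu nu = \sum_x nu x 0 * phi x - \sum_y mu y 0 * psi y.
Proof.
move=> pP le_dist tight; set c := RHS.
have costp : transport_cost e p = c.
  rewrite /c -(coupling_potential _ _ pP).
  apply: eq_bigr => x _; apply: eq_bigr => y _.
  by have [->|/tight->] := eqVneq (p x y) 0; rewrite ?mul0r.
have c_lb : lbound [set transport_cost e q | q in couplings mu nu]%classic c.
  move=> _ [q qP <-]; rewrite /c -(coupling_potential _ _ qP).
  apply: ler_sum => x _; apply: ler_sum => y _.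
  have [->|qxy] := eqVneq (q x y) 0; first by rewrite !mul0r.
  have /andP[nux muy] := coupling_supp qP qxy.
  by apply: ler_wpM2l (le_dist _ _ nux muy); case/couplingsP: qP.
apply/eqP; rewrite eq_le; apply/andP; split.
  by apply: ge_inf; [exists c | exists p].
by apply: lb_le_inf => //; exists c, p.
Qed.

(** The independent coupling, corrected by a matrix with zero row and column
    sums. *)
Definition perturbed_product t mu nu i j : 'M[R]_n :=
  \matrix_(x, y) (nu x 0 * mu y 0
                  - t * ((x == i)%:R - nu x 0) * ((y == j)%:R - mu y 0)).

Lemma sum_delta (i : 'I_n) : \sum_x (x == i)%:R = 1 :> R.
Proof.
by rewrite (bigD1 i) //= eqxx big1 ?addr0 // => x /negPf ->.
Qed.

Lemma perturbed_product_coupling t mu nu i j :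
  \sum_x mu x 0 = 1 -> \sum_x nu x 0 = 1 ->
  (forall x y, 0 <= perturbed_product t mu nu i j x y) ->
  couplings mu nu (perturbed_product t mu nu i j).
Proof.
move=> mu1 nu1 p_ge0; apply/couplingsP; split=> // z.
  under eq_bigr do rewrite mxE.
  rewrite sumrB -mulr_suml nu1 mul1r -mulr_suml -mulr_sumr sumrB.
  by rewrite sum_delta nu1 subrr mulr0 mul0r subr0.
under eq_bigr do rewrite mxE.
rewrite sumrB -mulr_sumr mu1 mulr1 -mulr_sumr sumrB.
by rewrite sum_delta mu1 subrr mulr0 subr0.
Qed.

Section Couplings.
Variables (mu nu : 'cV[R]_n) (i j : 'I_n).
Hypotheses (mu_ge0 : forall x, 0 <= mu x 0) (nu_ge0 : forall x, 0 <= nu x 0).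
Hypotheses (mu1 : \sum_x mu x 0 = 1) (nu1 : \sum_x nu x 0 = 1).

Let mass_le1 (m : 'cV[R]_n) z :
  (forall x, 0 <= m x 0) -> \sum_x m x 0 = 1 -> m z 0 <= 1.
Proof. by move=> m0 <-; rewrite (bigD1 z) //= lerDl sumr_ge0. Qed.

(** The correction is taken just large enough to cancel the entry at [(i, j)].
    The other entries in row [i] and column [j] only increase, and the remaining
    ones are multiplied by [1 - t]; the hypothesis is what makes [t <= 1]. *)
Lemma avoiding_coupling : nu i 0 + mu j 0 <= 1 ->
  exists2 p, couplings mu nu p & p i j = 0.
Proof.
move=> le_ab1; set a := mu j 0 in le_ab1; set b := nu i 0 in le_ab1.
have a1 : a <= 1 := mass_le1 j mu_ge0 mu1.
have b1 : b <= 1 := mass_le1 i nu_ge0 nu1.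
have a0 : 0 <= a := mu_ge0 j.
have b0 : 0 <= b := nu_ge0 i.
(* If the denominator vanishes, one of the two masses is 1 and the other 0;
   the value [t = 0] given by division by zero is then the right one. *)
pose t := (b * a) / ((1 - b) * (1 - a)).
have t_ge0 : 0 <= t by rewrite divr_ge0 ?mulr_ge0 ?subr_ge0.
have [t_le1 tE] : t <= 1 /\ t * ((1 - b) * (1 - a)) = b * a.
  rewrite /t; have [d0|d_neq0] := eqVneq ((1 - b) * (1 - a)) 0.
    rewrite d0 invr0 !mulr0 ler01; split=> //.
    by move/eqP: d0; rewrite mulf_eq0 => /orP[]/eqP d0; nra.
  have d_gt0 : 0 < (1 - b) * (1 - a).
    by rewrite lt_def d_neq0 mulr_ge0 // subr_ge0.
  by rewrite divfK // ler_pdivrMr // mul1r; split=> //; nra.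
clearbody t.
exists (perturbed_product t mu nu i j); last first.
  by rewrite mxE !eqxx -/a -/b -mulrA tE subrr.
apply: perturbed_product_coupling => // x y; rewrite mxE.
have := mu_ge0 y; have := nu_ge0 x.
have [->|_] := eqVneq x i; have [->|_] := eqVneq y j; rewrite -/a -/b /=.
- by rewrite -mulrA tE subrr.
- move=> _ muy; rewrite sub0r mulrN opprK.
  by rewrite addr_ge0 ?mulr_ge0 ?subr_ge0 //.
- move=> nux _; rewrite sub0r mulrN mulNr opprK.
  by rewrite addr_ge0 ?mulr_ge0 ?subr_ge0 //.
- move=> nux muy; rewrite !sub0r mulrN mulrN mulNr opprK -mulrA.
  by rewrite subr_ge0 ler_piMl ?mulr_ge0.
Qed.

(** For [t = 1] the matrix is [d_i x * mu y + nu x * d_j y - d_i x * d_j y], which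
    lives in row [i] and column [j]; only its entry at [(i, j)] can be negative,
    and the hypothesis prevents this. *)
Lemma hub_coupling : 1 <= nu i 0 + mu j 0 ->
  exists2 p, couplings mu nu p &
    forall x y, x != i -> y != j -> p x y = 0.
Proof.
move=> le1; exists (perturbed_product 1 mu nu i j); last first.
  by move=> x y /negPf xi /negPf yj; rewrite mxE xi yj !sub0r mul1r mulrNN subrr.
apply: perturbed_product_coupling => // x y; rewrite mxE.
have := mu_ge0 y; have := nu_ge0 x.
by have [->|_] := eqVneq x i; have [->|_] := eqVneq y j => /=; lra.
Qed.

End Couplings.
End Transport.

(** * Lazy random walks on a tree *)

Section LazyWalk.
Variables (R : realType) (n : nat) (e : rel 'I_n) (alpha : R).
Hypothesis treeP : is_tree e.
Implicit Types x y z i j : 'I_n.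

Definition step i : R := (1 - alpha) / (degree e i)%:R.

Lemma degree_gt0 i j : i != j -> (0 < degree e i)%N.
Proof.
move=> ij; have [y eiy _] := closer_neighbor treeP ij.
by apply/card_gt0P; exists y; rewrite inE.
Qed.

Lemma mulr_step_degree i j : i != j -> step i * (degree e i)%:R = 1 - alpha.
Proof.
by move=> ij; rewrite divfK // pnatr_eq0 -lt0n (degree_gt0 ij).
Qed.

Lemma lazy_walk_supp i x : lazy_walk e alpha i x 0 != 0 -> (x == i) || e i x.
Proof.
by rewrite mxE; case: (x == i) => //; case: (e i x) => //; rewrite eqxx.
Qed.

Lemma lazy_walk_expectation i (f : 'I_n -> R) :
  \sum_x lazy_walk e alpha i x 0 * f x =
  alpha * f i + step i * \sum_(x | e i x) f x.
Proof.
have adj_irr : irreflexive e by case: treeP.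
rewrite (bigD1 i) //= mxE eqxx; congr (_ + _).
rewrite mulr_sumr big_mkcond [RHS]big_mkcond; apply: eq_bigr => x _.
rewrite mxE; have [->|_] := eqVneq x i; first by rewrite adj_irr.
by case: (e i x) => //=; rewrite mul0r.
Qed.

Lemma sum_adj_const i (c : R) : \sum_(x | e i x) c = (degree e i)%:R * c.
Proof. by rewrite sumr_const mulr_natl /degree cardsE. Qed.

Lemma lazy_walk_mass i j : i != j -> \sum_x lazy_walk e alpha i x 0 = 1.
Proof.
move=> ij; under eq_bigr => x _ do rewrite -[lazy_walk _ _ _ _ _]mulr1.
rewrite (lazy_walk_expectation i (fun=> 1)) sum_adj_const !mulr1.
by rewrite (mulr_step_degree ij); ring.
Qed.

(** All neighbours of [i] are at distance [dist i j + 1] from [j], except the one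
    on the way to [j], whose distance is smaller by 2. *)
Lemma lazy_walk_mean_dist i j : i != j ->
  \sum_x lazy_walk e alpha i x 0 * (dist e x j)%:R =
  (dist e i j)%:R + (1 - alpha) - 2 * step i.
Proof.
move=> ij; rewrite (lazy_walk_expectation i (fun x => (dist e x j)%:R)).
have [y eiy dy] := closer_neighbor treeP ij.
have -> : \sum_(x | e i x) (dist e x j)%:R =
          \sum_(x | e i x) ((dist e i j)%:R + 1) - 2 :> R.
  rewrite (bigD1 y) //= [in RHS](bigD1 y) //= dy -natr1.
  rewrite (eq_bigr (fun=> (dist e y j).+1%:R + 1)).
    by rewrite -natr1; ring.
  move=> x /andP[eix xy]; rewrite -dy.
  case: (dist_neighbor treeP j eix) => [dx|->]; last by rewrite natr1.
  by rewrite (closer_neighbor_uniq treeP eix eiy dx dy) eqxx in xy.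
rewrite sum_adj_const mulrBr mulrA (mulr_step_degree ij); ring.
Qed.

Hypotheses (alpha_ge0 : 0 <= alpha) (alpha_lt1 : alpha < 1).

Lemma lazy_walk_ge0 i x : 0 <= lazy_walk e alpha i x 0.
Proof.
rewrite mxE; case: ifP => // _; case: ifP => // _.
by rewrite divr_ge0 ?ler0n // subr_ge0 ltW.
Qed.

Lemma lazy_walk_neighbor i x : i != x ->
  lazy_walk e alpha i x 0 = if e i x then step i else 0.
Proof. by rewrite mxE eq_sym => /negPf ->. Qed.

(** If [i] and [j] are not adjacent, [(i, j)] is outside the product of the
    supports and the correction in [avoiding_coupling] disappears: the
    independent coupling is optimal. *)
Lemma W1_forward i j : i != j -> (e i j -> step i + step j <= 1) ->
  W1 e (lazy_walk e alpha i) (lazy_walk e alpha j) =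
  (dist e i j)%:R + 2 * (1 - alpha) - 2 * (step i + step j).
Proof.
move=> ij le1; have ji : j != i by rewrite eq_sym.
have adj_sym : symmetric e by case: treeP.
have [p pP pij0] : exists2 p,
    couplings (lazy_walk e alpha i) (lazy_walk e alpha j) p & p i j = 0.
  apply: avoiding_coupling; first exact: lazy_walk_ge0.
  - exact: lazy_walk_ge0.
  - exact: lazy_walk_mass ij.
  - exact: lazy_walk_mass ji.
  rewrite !lazy_walk_neighbor // (adj_sym j).
  by case: ifP le1 => [_ /(_ isT)|_ _]; rewrite ?addr0 // addrC.
pose D : R := (dist e i j)%:R.
have tight x y : (x == j) || e j x -> (y == i) || e i y ->
    ~~ ((x == i) && (y == j)) ->
    (dist e x y)%:R = (dist e x i)%:R - (D - (dist e y j)%:R).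
  move=> xj yi xy; have := tight_near_endpoints treeP ij xj yi xy.
  rewrite (dist_sym treeP i x) => /(congr1 (GRing.natmul (1 : R))).
  by rewrite !natrD /D => dE; lra.
rewrite (W1_duality (p := p) (phi := fun x => (dist e x i)%:R)
           (psi := fun y => D - (dist e y j)%:R)) //.
- under [X in _ - X]eq_bigr do rewrite mulrBr.
  rewrite sumrB -mulr_suml (lazy_walk_mass ij) !lazy_walk_mean_dist //.
  by rewrite (dist_sym treeP j i) -/D; ring.
- move=> x y /lazy_walk_supp xj /lazy_walk_supp yi.
  have [/andP[/eqP-> /eqP->]|xy] := boolP ((x == i) && (y == j)); last first.
    by rewrite -tight.
  rewrite !dist_refl // -/D; have : 0 <= D by rewrite ler0n.
  by lra.
move=> x y pxy.
have /andP[/lazy_walk_supp xj /lazy_walk_supp yi] := coupling_supp pP pxy.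
by apply: tight => //; apply: contraNN pxy => /andP[/eqP-> /eqP->]; rewrite pij0.
Qed.

(** The potentials are the two restrictions of the height that is -1 at [j] and
    at the neighbours of [i], and 0 at [i] and at the neighbours of [j].  They
    differ by at most 1, so domination by the distance only matters at [x = y],
    where it fails only for a common neighbour of [i] and [j]; a tree has no
    triangle. *)
Lemma W1_backward i j : e i j -> 1 <= step i + step j ->
  W1 e (lazy_walk e alpha i) (lazy_walk e alpha j) = 1 - 2 * alpha.
Proof.
move=> eij ge1; have ij := edge_neq treeP eij.
have ji : j != i by rewrite eq_sym.
have adj_sym : symmetric e by case: treeP.
have eji : e j i by rewrite adj_sym.
have [p pP p0] : exists2 p,
    couplings (lazy_walk e alpha i) (lazy_walk e alpha j) p &
    forall x y, x != i -> y != j -> p x y = 0.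
  apply: hub_coupling; first exact: lazy_walk_ge0.
  - exact: lazy_walk_ge0.
  - exact: lazy_walk_mass ij.
  - exact: lazy_walk_mass ji.
  by rewrite !lazy_walk_neighbor // eij eji addrC.
rewrite (W1_duality (p := p) (phi := fun x => - (x == j)%:R)
           (psi := fun y => - (y != i)%:R)) //.
- rewrite !lazy_walk_expectation !eqxx /=.
  have adj_ne u v : e u v -> (v == u) = false.
    by rewrite eq_sym => /(edge_neq treeP)/negPf.
  rewrite big1 => [|x /adj_ne->]; last by rewrite oppr0.
  rewrite (eq_bigr (fun=> - 1)) => [|x /adj_ne-> //].
  by rewrite sum_adj_const mulrA (mulr_step_degree ij); ring.
- move=> x y /lazy_walk_supp xj /lazy_walk_supp yi.
  have [xy|xy] := eqVneq x y; last first.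
    have : 1 <= (dist e x y)%:R :> R by rewrite ler1n lt0n dist_eq0.
    by case: (x == j); case: (y != i) => /=; lra.
  rewrite -{y}xy in yi *; rewrite dist_refl //.
  have [_|/negPf xNj] := eqVneq x j; first by case: (x != i) => /=; lra.
  have [_|/negPf xNi] /= := eqVneq x i; first by lra.
  rewrite xNj xNi /= in xj yi.
  by case: (dist_neighbor treeP x eij); rewrite !dist_edge.
move=> x y pxy.
have /andP[/lazy_walk_supp xj /lazy_walk_supp yi] := coupling_supp pP pxy.
have [xi|xi] := eqVneq x i.
  rewrite xi (negPf ij); have [->|yNi] /= := eqVneq y i.
    by rewrite dist_refl //; lra.
  by rewrite (negPf yNi) /= in yi; rewrite dist_edge //; lra.
have [yj|yj] := eqVneq y j; last by rewrite p0 // eqxx in pxy.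
rewrite yj (negPf ji) /=; have [->|xNj] /= := eqVneq x j.
  by rewrite dist_refl //; lra.
by rewrite (negPf xNj) /= in xj; rewrite dist_sym // dist_edge //; lra.
Qed.

End LazyWalk.

Theorem corollary3p4 (R : realType) (n : nat) (e : rel 'I_n) (i j : 'I_n)
    (alpha : R) :
  is_tree e -> i != j -> 0 <= alpha -> alpha < 1 ->
  [/\ e i j ->
      [/\ (degree e i)%:R^-1 + (degree e j)%:R^-1 > (1 - alpha)^-1 ->
            ollivier_ricci e alpha i j = 2 * alpha,
          (degree e i)%:R^-1 + (degree e j)%:R^-1 <= (1 - alpha)^-1 ->
            ollivier_ricci e alpha i j =
              2 * (1 - alpha) *
                ((degree e i)%:R^-1 + (degree e j)%:R^-1 - 1)
        & 2^-1 <= alpha ->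
            (degree e i)%:R^-1 + (degree e j)%:R^-1 <= (1 - alpha)^-1]
    & ~~ e i j ->
      ollivier_ricci e alpha i j =
        2 * (1 - alpha) / (dist e i j)%:R *
          ((degree e i)%:R^-1 + (degree e j)%:R^-1 - 1)].
Proof.
move=> treeP ij alpha_ge0 alpha_lt1.
have beta_gt0 : 0 < 1 - alpha by rewrite subr_gt0.
have ji : j != i by rewrite eq_sym.
set u := _%:R^-1; set v := _%:R^-1.
rewrite /ollivier_ricci; split=> [eij|Neij]; last first.
  have D_neq0 : (dist e i j)%:R != 0 :> R by rewrite pnatr_eq0 dist_eq0.
  rewrite W1_forward //; last by rewrite (negPf Neij).
  by rewrite /step -/u -/v; field.
rewrite (dist_edge treeP eij) divr1; split.
- move=> lt_uv; rewrite W1_backward //; first by ring.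
  by rewrite /step -mulrDr mulrC -ler_pdivrMr // div1r ltW.
- move=> le_uv; rewrite W1_forward //.
    by rewrite dist_edge // /step -/u -/v; ring.
  by rewrite /step -mulrDr mulrC -ler_pdivlMr // div1r.
move=> ge_half.
have u1 : u <= 1 by rewrite invf_le1 ?ltr0n ?ler1n (degree_gt0 treeP ij).
have v1 : v <= 1 by rewrite invf_le1 ?ltr0n ?ler1n (degree_gt0 treeP ji).
have : 2 <= (1 - alpha)^-1.
  by rewrite -[2]invrK lef_pV2 ?posrE ?invr_gt0 ?ltr0n //; lra.
by lra.
Qed.
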